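(* Let $K$ be a field, $\lambda\in K$, and let $(A,\mu,1,\alpha_A,\beta_A,\psi_A,\omega_A,r)$ be an anti-quasitriangular unitary $\lambda$-infBH-bialgebra over $K$, with comultiplication $\widetilde{\Delta}_r$. Let $(M,\widetilde{\gamma},\alpha_M,\beta_M)$ be a left $(A,\mu,\alpha_A,\beta_A)$-module, written $\widetilde{\gamma}(a\otimes m)=a\triangleright m$, and let $\psi_M,\omega_M:M\to M$ be linear maps such that $\beta_M\circ\psi_M=\psi_M\circ\beta_M$ and $\psi_M\circ\widetilde{\gamma}=\widetilde{\gamma}\circ(\psi_A\otimes\psi_M)$. Then $(M,\widetilde{\gamma},\widetilde{\rho},\alpha_M,\beta_M,\psi_M,\omega_M)$ becomes a left $\lambda$-infBH-Hopf module over $(A,\mu,\widetilde{\Delta}_r,\alpha_A,\beta_A,\psi_A,\omega_A)$ with the coaction $\widetilde{\rho}:M\to A\otimes M$ given by $$\widetilde{\rho}(m)=-\alpha_A(r^1)\otimes r^2\triangleright\psi_M\beta_M^{-1}(m)-\lambda\,1\otimes\psi_M(m),\qquad m\in M,$$ where $\beta_M^{-1}$ is the inverse of $\beta_M$ (taken to exist).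
   Context: A BiHom-associative algebra $(A,\mu,\alpha,\beta)$ consists of a vector space $A$ and linear maps $\mu:A\otimes A\to A$ (written $ab$), $\alpha,\beta:A\to A$ with $\alpha\beta=\beta\alpha$, $\alpha(ab)=\alpha(a)\alpha(b)$, $\beta(ab)=\beta(a)\beta(b)$, $\alpha(a)(bc)=(ab)\beta(c)$. It is unitary with unit $1$ if $\alpha(1)=1=\beta(1)$, $a1=\alpha(a)$, $1a=\beta(a)$. A BiHom-coassociative coalgebra $(C,\Delta,\psi,\omega)$ consists of a vector space $C$ and linear maps $\Delta:C\to C\otimes C$ (written $c_1\otimes c_2$), $\psi,\omega:C\to C$ with $\psi\omega=\omega\psi$, $(\psi\otimes\psi)\Delta=\Delta\psi$, $(\omega\otimes\omega)\Delta=\Delta\omega$, $(\Delta\otimes\psi)\Delta=(\omega\otimes\Delta)\Delta$. A $\lambda$-infBH-bialgebra $(A,\mu,\Delta,\alpha,\beta,\psi,\omega)$ is a BiHom-associative algebra $(A,\mu,\alpha,\beta)$ that is also a BiHom-coassociative coalgebra $(A,\Delta,\psi,\omega)$, such that each of $\alpha,\beta$ commutes with each of $\psi,\omega$, $(\alpha\otimes\alpha)\Delta=\Delta\alpha$, $(\beta\otimes\beta)\Delta=\Delta\beta$, $\psi$ and $\omega$ are multiplicative, and $\Delta(ab)=\omega(a)b_1\otimes\beta(b_2)+\alpha(a_1)\otimes a_2\psi(b)+\lambda\,\alpha\omega(a)\otimes\beta\psi(b)$. An anti-quasitriangular unitary $\lambda$-infBH-bialgebra $(A,\mu,1,\alpha,\beta,\psi,\omega,r)$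 consists of a unitary BiHom-associative algebra $(A,\mu,1,\alpha,\beta)$ with $\alpha,\beta$ bijective, linear maps $\psi,\omega:A\to A$ with $\alpha\psi=\psi\alpha$, $\alpha\omega=\omega\alpha$, $\beta\psi=\psi\beta$, $\beta\omega=\omega\beta$, $\psi,\omega$ multiplicative, $\psi(1)=1=\omega(1)$, and an element $r=r^1\otimes r^2\in A\otimes A$ with $(f\otimes f)(r)=r$ for $f\in\{\alpha,\beta,\psi,\omega\}$, such that $r_{13}r_{12}-r_{12}r_{23}+r_{23}r_{13}=-\lambda r_{13}$, where (with $\bar r=r$) $r_{12}r_{23}=\alpha(r^1)\otimes r^2\bar r^1\otimes\beta(\bar r^2)$, $r_{13}r_{12}=\omega(r^1)\bar r^1\otimes\beta(\bar r^2)\otimes\alpha\psi(r^2)$, $r_{23}r_{13}=\beta\omega(r^1)\otimes\alpha(\bar r^1)\otimes\bar r^2\psi(r^2)$, $r_{13}=\omega(r^1)\otimes1\otimes\psi(r^2)$. It is regarded as a $\lambda$-infBH-bialgebra $(A,\mu,\widetilde{\Delta}_r,\alpha,\beta,\psi,\omega)$ with comultiplication $\widetilde{\Delta}_r(a)=\omega\alpha^{-1}(a)r^1\otimes\beta(r^2)-\alpha(r^1)\otimes r^2\psi\beta^{-1}(a)-\lambda(1\otimes\psi(a))$. A left $(A,\mu,\alpha_A,\beta_A)$-module $(M,\gamma,\alpha_M,\beta_M)$: a vector space $M$ with linear maps $\alpha_M,\beta_M:M\to M$, $\gamma:A\otimes M\to M$, $\gamma(a\otimes m)=a\triangleright m$,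 such that $\alpha_M\beta_M=\beta_M\alpha_M$, $\alpha_M(a\triangleright m)=\alpha_A(a)\triangleright\alpha_M(m)$, $\beta_M(a\triangleright m)=\beta_A(a)\triangleright\beta_M(m)$, $\alpha_A(a)\triangleright(a'\triangleright m)=(aa')\triangleright\beta_M(m)$. A left $(A,\Delta,\psi_A,\omega_A)$-comodule $(M,\rho,\psi_M,\omega_M)$: linear maps $\psi_M,\omega_M:M\to M$, $\rho:M\to A\otimes M$ (written $\rho(m)=m_{-1}\otimes m_0$) with $\psi_M\omega_M=\omega_M\psi_M$, $\rho\psi_M=(\psi_A\otimes\psi_M)\rho$, $\rho\omega_M=(\omega_A\otimes\omega_M)\rho$, $(\Delta\otimes\psi_M)\rho=(\omega_A\otimes\rho)\rho$. A left $\lambda$-infBH-Hopf module $(M,\gamma,\rho,\alpha_M,\beta_M,\psi_M,\omega_M)$ over a $\lambda$-infBH-bialgebra $(A,\mu,\Delta,\alpha_A,\beta_A,\psi_A,\omega_A)$: $(M,\gamma,\alpha_M,\beta_M)$ is a left module, $(M,\rho,\psi_M,\omega_M)$ is a left comodule, any two of $\alpha_M,\beta_M,\psi_M,\omega_M$ commute, and $$(a\triangleright m)_{-1}\otimes(a\triangleright m)_0=\omega_A(a)m_{-1}\otimes\beta_M(m_0)+\alpha_A(a_1)\otimes a_2\triangleright\psi_M(m)+\lambda\,\alpha_A\omega_A(a)\otimes\beta_M\psi_M(m).$$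
   Formalization: Added, since the claim fails without them: ψ_A and ω_A commute; α_M commutes with ψ_M and ω_M, β_M with ω_M, ψ_M with ω_M; and ω_M∘γ̃ = γ̃∘(ω_A⊗ω_M), the counterpart of the stated condition on ψ_M. *)

(* Defs.v *)
From HB Require Import structures.
From mathcomp Require Import all_boot all_algebra.
From mathcomp Require Import boolp.

Set Implicit Arguments.
Unset Strict Implicit.
Unset Printing Implicit Defensive.

Import GRing.Theory.

Local Open Scope ring_scope.
Local Open Scope quotient_scope.

(* The tensor product of two (arbitrary-dimensional) vector spaces, presented
   by generators and relations.  The list [:: (u1, v1); ...; (un, vn)] stands
   for the formal sum u1 (x) v1 + ... + un (x) vn; no scalars are needed, since
   they are absorbed by the first factor. *)
Section TensorProduct.
Variables (K : fieldType) (U V : lmodType K).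

Inductive tensor_cong : seq (U * V) -> seq (U * V) -> Prop :=
| tc_refl s : tensor_cong s s
| tc_sym s t : tensor_cong s t -> tensor_cong t s
| tc_trans s t w : tensor_cong s t -> tensor_cong t w -> tensor_cong s w
| tc_cat s s' t t' :
    tensor_cong s s' -> tensor_cong t t' -> tensor_cong (s ++ t) (s' ++ t')
| tc_catC s t : tensor_cong (s ++ t) (t ++ s)
| tc_0l v : tensor_cong [:: (0, v)] [::]
| tc_Dl u u' v : tensor_cong [:: (u + u', v)] [:: (u, v); (u', v)]
| tc_Dr u v v' : tensor_cong [:: (u, v + v')] [:: (u, v); (u, v')]
| tc_Z a u v : tensor_cong [:: (a *: u, v)] [:: (u, a *: v)].

Definition tensor_rel : rel (seq (U * V)) := fun s t => `[< tensor_cong s t >].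

Lemma tensor_rel_refl : reflexive tensor_rel.
Proof. by move=> s; apply/asboolP; exact: tc_refl. Qed.

Lemma tensor_rel_sym : symmetric tensor_rel.
Proof. by move=> s t; apply/asboolP/asboolP; exact: tc_sym. Qed.

Lemma tensor_rel_trans : transitive tensor_rel.
Proof.
by move=> t s w /asboolP st /asboolP tw; apply/asboolP; exact: tc_trans tw.
Qed.

Canonical tensor_equiv :=
  EquivRel tensor_rel tensor_rel_refl tensor_rel_sym tensor_rel_trans.

Definition tensor : Type := {eq_quot tensor_equiv}.

HB.instance Definition _ := Choice.on tensor.
HB.instance Definition _ := EqQuotient.on tensor.

Definition tens_class (s : seq (U * V)) : tensor := \pi_tensor s.

Lemma tens_classE s t : tensor_cong s t <-> tens_class s = tens_class t.
Proof.
split=> [st|/eqmodP /asboolP //]; by apply/eqmodP/asboolP.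
Qed.

Lemma repr_cong s : tensor_cong (repr (tens_class s)) s.
Proof. by apply/tens_classE; rewrite /tens_class reprK. Qed.

Lemma tens_class_repr (t : tensor) : tens_class (repr t) = t.
Proof. exact: reprK. Qed.

Definition scale_seq (a : K) (s : seq (U * V)) := [seq (a *: p.1, p.2) | p <- s].

Lemma scale_seq_cong a s t :
  tensor_cong s t -> tensor_cong (scale_seq a s) (scale_seq a t).
Proof.
elim=> {s t} /=.
- by move=> s; exact: tc_refl.
- by move=> s t _; exact: tc_sym.
- by move=> s t w _ + _; exact: tc_trans.
- by move=> s s' t t' _ + _; rewrite /scale_seq !map_cat; exact: tc_cat.
- by move=> s t; rewrite /scale_seq !map_cat; exact: tc_catC.
- by move=> v; rewrite scaler0; exact: tc_0l.
- by move=> u u' v; rewrite scalerDr; exact: tc_Dl.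
- by move=> u v v'; exact: tc_Dr.
- by move=> b u v; rewrite scalerA mulrC -scalerA; exact: tc_Z.
Qed.

Definition tens_zero : tensor := tens_class [::].
Definition tens_add (x y : tensor) : tensor := tens_class (repr x ++ repr y).
Definition tens_scale (a : K) (x : tensor) : tensor :=
  tens_class (scale_seq a (repr x)).
Definition tens_opp (x : tensor) : tensor := tens_scale (-1) x.

Lemma tens_class_cat s t :
  tens_class (s ++ t) = tens_add (tens_class s) (tens_class t).
Proof. by apply/tens_classE/tc_cat; apply: tc_sym; exact: repr_cong. Qed.

Lemma tens_class_cons p s :
  tens_class (p :: s) = tens_add (tens_class [:: p]) (tens_class s).
Proof. exact: (tens_class_cat [:: p]). Qed.

Lemma tens_class_scale a s :
  tens_class (scale_seq a s) = tens_scale a (tens_class s).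
Proof. by apply/tens_classE/scale_seq_cong/tc_sym/repr_cong. Qed.

Lemma tensW (P : tensor -> Prop) :
  (forall s, P (tens_class s)) -> forall t, P t.
Proof. by move=> H t; rewrite -(tens_class_repr t). Qed.

Lemma tens_addA : associative tens_add.
Proof.
elim/tensW=> s; elim/tensW=> t; elim/tensW=> w.
by rewrite -!tens_class_cat catA.
Qed.

Lemma tens_addC : commutative tens_add.
Proof.
elim/tensW=> s; elim/tensW=> t.
by rewrite -!tens_class_cat; apply/tens_classE/tc_catC.
Qed.

Lemma tens_addACA : interchange tens_add tens_add.
Proof.
by move=> x y z t; rewrite -!tens_addA (tens_addA y) (tens_addC y) -(tens_addA z).
Qed.

Lemma tens_add0 : left_id tens_zero tens_add.
Proof. by elim/tensW=> s; rewrite -tens_class_cat. Qed.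

Lemma tens_scaleDl x : {morph tens_scale^~ x : a b / a + b >-> tens_add a b}.
Proof.
elim/tensW: x => s a b; rewrite -!tens_class_scale.
elim: s => [|[u v] s IH]; first by rewrite /= -/tens_zero tens_add0.
rewrite /= (tens_class_cons (_, _) (scale_seq (a + b) s)) IH scalerDl.
rewrite (tens_class_cons _ (scale_seq a s)) (tens_class_cons _ (scale_seq b s)).
have -> : tens_class [:: (a *: u + b *: u, v)] =
    tens_add (tens_class [:: (a *: u, v)]) (tens_class [:: (b *: u, v)]).
  by rewrite -tens_class_cat; apply/tens_classE/tc_Dl.
exact: tens_addACA.
Qed.

Lemma tens_scale0 x : tens_scale 0 x = tens_zero.
Proof.
elim/tensW: x => s; rewrite -tens_class_scale.
elim: s => [//|[u v] s IH]; rewrite /= (tens_class_cons _ (scale_seq 0 s)) IH.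
rewrite scale0r tens_addC tens_add0; exact/tens_classE/tc_0l.
Qed.

Lemma tens_scaleA a b x : tens_scale a (tens_scale b x) = tens_scale (a * b) x.
Proof.
elim/tensW: x => s; rewrite -!tens_class_scale; congr tens_class.
by rewrite /scale_seq -map_comp; apply: eq_map => p /=; rewrite scalerA.
Qed.

Lemma tens_scale1 : left_id 1 tens_scale.
Proof.
elim/tensW=> s; rewrite -tens_class_scale /scale_seq; congr tens_class.
by rewrite -[RHS]map_id; apply: eq_map => -[u v] /=; rewrite scale1r.
Qed.

Lemma tens_scaleDr : right_distributive tens_scale tens_add.
Proof.
move=> a; elim/tensW=> s; elim/tensW=> t.
by rewrite -tens_class_cat -!tens_class_scale -tens_class_cat /scale_seq map_cat.
Qed.

Lemma tens_addN : left_inverse tens_zero tens_opp tens_add.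
Proof.
move=> x; rewrite -{2}(tens_scale1 x) -(tens_scaleDl x).
by rewrite addNr tens_scale0.
Qed.

HB.instance Definition _ :=
  GRing.isZmodule.Build tensor tens_addA tens_addC tens_add0 tens_addN.
HB.instance Definition _ := GRing.Zmodule_isLmodule.Build K tensor
  tens_scaleA tens_scale1 tens_scaleDr (fun x a b => tens_scaleDl x a b).

Lemma tens_class_catE s t :
  tens_class (s ++ t) = (tens_class s : tensor) + (tens_class t : tensor).
Proof. exact: tens_class_cat. Qed.

Lemma tens_class_scaleE a s :
  tens_class (scale_seq a s) = a *: (tens_class s : tensor).
Proof. exact: tens_class_scale. Qed.

Definition tens (u : U) (v : V) : tensor := tens_class [:: (u, v)].

Lemma tens_linearl v : linear (tens^~ v).
Proof.
move=> a u u'; rewrite /tens -tens_class_scaleE /=.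
rewrite -tens_class_catE; exact/tens_classE/tc_Dl.
Qed.

Lemma tens_linearr u : linear (tens u).
Proof.
move=> a v v'; rewrite /tens -tens_class_scaleE /=.
rewrite -tens_class_catE; apply/tens_classE; apply: tc_trans (tc_Dr _ _ _) _.
exact: tc_cat (tc_sym (tc_Z a u v)) (tc_refl [:: (u, v')]).
Qed.

Lemma tens_classS s : tens_class s = \sum_(p <- s) tens p.1 p.2.
Proof.
elim: s => [|[u v] s IH]; first by rewrite big_nil.
by rewrite big_cons (tens_class_cons _ s) IH.
Qed.

End TensorProduct.

Notation "u ⊗ v" := (tens u v)
  (at level 37, right associativity) : ring_scope.

(* Sweedler notation: for t = \sum_i u_i ⊗ v_i, the value
   \tsum_(x, y <- t) E x y is \sum_i E (u_i) (v_i).  It is computed on a chosen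
   presentation of t; when E is bilinear the result does not depend on that
   choice (tsum_class) and is the value at t of the linear map induced by E
   (tsum_tens, tsum_linear, tsum_unique). *)
Definition tsum (K : fieldType) (U V W : lmodType K) (E : U -> V -> W)
  (t : tensor U V) : W := \sum_(p <- repr t) E p.1 p.2.

Lemma eq_tsumP (K : fieldType) (U V W : lmodType K) (c : K)
    (E F G : U -> V -> W) (t : tensor U V) :
  (forall x y, E x y = c *: F x y + G x y) ->
  tsum E t = c *: tsum F t + tsum G t.
Proof.
by move=> H; rewrite /tsum scaler_sumr -big_split; apply: eq_bigr => p _.
Qed.

Notation "\tsum_ ( x , y <- t ) E" := (tsum (fun x y => E) t)
  (at level 41, x name, y name, E at level 41,
   format "\tsum_ ( x ,  y  <-  t )  E") : ring_scope.

Section UniversalProperty.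
Variables (K : fieldType) (U V W : lmodType K) (E : U -> V -> W).
Hypothesis linl : forall v, linear (E^~ v).
Hypothesis linr : forall u, linear (E u).

Let lin0 (X : lmodType K) (f : X -> W) : linear f -> f 0 = 0.
Proof. by move=> /(_ (-1) 0 0); rewrite !scaleN1r oppr0 addr0 addNr. Qed.

Let linD (X : lmodType K) (f : X -> W) : linear f -> {morph f : x y / x + y}.
Proof. by move=> lf x y; have := lf 1 x y; rewrite !scale1r. Qed.

Let linZ (X : lmodType K) (f : X -> W) a x : linear f -> f (a *: x) = a *: f x.
Proof. by move=> lf; rewrite -[a *: x]addr0 lf lin0 ?addr0. Qed.

Lemma sum_cong s t : tensor_cong s t ->
  \sum_(p <- s) E p.1 p.2 = \sum_(p <- t) E p.1 p.2.
Proof.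
elim=> {s t} //=.
- by move=> s t w _ -> _ ->.
- by move=> s s' t t' _ + _ +; rewrite !big_cat /= => -> ->.
- by move=> s t; rewrite !big_cat /= addrC.
- by move=> v; rewrite big_seq1 big_nil /=; exact: (lin0 (linl v)).
- by move=> u u' v; rewrite !big_cons big_nil !addr0 /=; exact: (linD (linl v)).
- by move=> u v v'; rewrite !big_cons big_nil !addr0 /=; exact: (linD (linr u)).
- move=> a u v; rewrite !big_seq1 /=.
  by rewrite [LHS](linZ a u (linl v)) (linZ a v (linr u)).
Qed.

Lemma tsum_class s : tsum E (tens_class s) = \sum_(p <- s) E p.1 p.2.
Proof. exact: sum_cong (repr_cong s). Qed.

Lemma tsum_tens u v : tsum E (u ⊗ v) = E u v.
Proof. by rewrite /tens tsum_class big_seq1. Qed.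

Lemma tsum_linear : linear (tsum E).
Proof.
move=> a; elim/tensW=> s; elim/tensW=> t.
rewrite -tens_class_scaleE -tens_class_catE.
rewrite !tsum_class big_cat /= big_map scaler_sumr; congr (_ + _).
by apply: eq_bigr => p _ /=; exact: (linZ a p.1 (linl p.2)).
Qed.

Lemma tsum_unique (f : {linear tensor U V -> W}) :
  (forall u v, f (u ⊗ v) = E u v) -> f =1 tsum E.
Proof.
move=> fE; elim/tensW=> s; rewrite tsum_class tens_classS linear_sum.
by apply: eq_bigr => p _; rewrite fE.
Qed.

End UniversalProperty.

Section TensorMaps.
Variable K : fieldType.

Definition tmap (U U' V V' : lmodType K) (f : U -> U') (g : V -> V')
  (t : tensor U V) : tensor U' V' := \tsum_(x, y <- t) (f x ⊗ g y).

Definition tassoc (U V W : lmodType K) (t : tensor (tensor U V) W) : tensor U (tensor V W) :=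
  \tsum_(p, z <- t) \tsum_(x, y <- p) (x ⊗ (y ⊗ z)).

End TensorMaps.

Notation "f ⊠ g" := (tmap f g) (at level 37, right associativity) : ring_scope.

(* The inverse of a bijective linear map, and 0 if f is not bijective; the
   default value makes it linear for every f. *)
Section LinearInverse.
Variables (K : fieldType) (U V : lmodType K) (f : {linear U -> V}).

Definition linv (y : V) : U :=
  if pselect (exists x, bijective f /\ f x = y) is left ex
  then sval (cid ex) else 0.

Lemma linvK : bijective f -> cancel f linv.
Proof.
move=> bij_f x; rewrite /linv; case: pselect => [ex|[]]; last by exists x.
by case: (cid ex) => z /= [_ /(bij_inj bij_f)].
Qed.

Lemma linvVK : bijective f -> cancel linv f.
Proof.
move=> bij_f y; rewrite /linv; case: pselect => [ex|[]].
  by case: (cid ex) => z [].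
by case: bij_f (bij_f) => g _ gK bij_f; exists (g y).
Qed.

Lemma linv_is_linear : linear linv.
Proof.
move=> a x y; case: (pselect (bijective f)) => [bij_f|nbij_f].
  by apply: (bij_inj bij_f); rewrite linearP !linvVK.
have linv0 z : linv z = 0.
  by rewrite /linv; case: pselect => // ex; case: (nbij_f); case: ex => ? [].
by rewrite !linv0 scaler0 addr0.
Qed.

HB.instance Definition _ := GRing.isLinear.Build K V U _ linv linv_is_linear.

End LinearInverse.

Definition commuting (T : Type) (f g : T -> T) := forall x, f (g x) = g (f x).

Section Algebra.
Variables (K : fieldType) (A : lmodType K).
Variables (mu : {linear tensor A A -> A}) (one : A) (alpha beta : {linear A -> A}).
Local Notation "a ∙ b" := (mu (a ⊗ b)) (at level 36, right associativity).

Definition multiplicative_map (f : A -> A) :=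
  forall a b, f (a ∙ b) = f a ∙ f b.

Record BiHom_associative : Prop := {
  bha_comm : commuting alpha beta;
  bha_alphaM : multiplicative_map alpha;
  bha_betaM : multiplicative_map beta;
  bha_assoc : forall a b c, alpha a ∙ (b ∙ c) = (a ∙ b) ∙ beta c
}.

Record unitary_BiHom_associative : Prop := {
  ubha_assoc : BiHom_associative;
  ubha_alpha1 : alpha one = one;
  ubha_beta1 : beta one = one;
  ubha_mulr1 : forall a, a ∙ one = alpha a;
  ubha_mul1r : forall a, one ∙ a = beta a
}.

End Algebra.

Record BiHom_coassociative (K : fieldType) (C : lmodType K)
    (Delta : {linear C -> tensor C C}) (psi omega : {linear C -> C}) : Prop := {
  bhc_comm : commuting psi omega;
  bhc_psi : forall c, (psi ⊠ psi) (Delta c) = Delta (psi c);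
  bhc_omega : forall c, (omega ⊠ omega) (Delta c) = Delta (omega c);
  bhc_coassoc : forall c,
    tassoc ((Delta ⊠ psi) (Delta c)) = (omega ⊠ Delta) (Delta c)
}.

Section Bialgebra.
Variables (K : fieldType) (lambda : K) (A : lmodType K).
Variables (mu : {linear tensor A A -> A}) (Delta : {linear A -> tensor A A}).
Variables (alpha beta psi omega : {linear A -> A}).
Local Notation "a ∙ b" := (mu (a ⊗ b)) (at level 36, right associativity).

Record infBH_bialgebra : Prop := {
  ibh_alg : BiHom_associative mu alpha beta;
  ibh_coalg : BiHom_coassociative Delta psi omega;
  ibh_alpha_psi : commuting alpha psi;
  ibh_alpha_omega : commuting alpha omega;
  ibh_beta_psi : commuting beta psi;
  ibh_beta_omega : commuting beta omega;
  ibh_Delta_alpha : forall a, (alpha ⊠ alpha) (Delta a) = Delta (alpha a);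
  ibh_Delta_beta : forall a, (beta ⊠ beta) (Delta a) = Delta (beta a);
  ibh_psiM : multiplicative_map mu psi;
  ibh_omegaM : multiplicative_map mu omega;
  ibh_compat : forall a b, Delta (a ∙ b) =
      (\tsum_(b1, b2 <- Delta b) (omega a ∙ b1 ⊗ beta b2))
    + (\tsum_(a1, a2 <- Delta a) (alpha a1 ⊗ a2 ∙ psi b))
    + lambda *: (alpha (omega a) ⊗ beta (psi b))
}.

End Bialgebra.

Section AntiQuasitriangular.
Variables (K : fieldType) (lambda : K) (A : lmodType K).
Variables (mu : {linear tensor A A -> A}) (one : A).
Variables (alpha beta psi omega : {linear A -> A}) (r : tensor A A).
Local Notation "a ∙ b" := (mu (a ⊗ b)) (at level 36, right associativity).

Definition r12r23 : tensor A (tensor A A) :=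
  \tsum_(r1, r2 <- r) \tsum_(s1, s2 <- r) (alpha r1 ⊗ r2 ∙ s1 ⊗ beta s2).

Definition r13r12 : tensor A (tensor A A) :=
  \tsum_(r1, r2 <- r) \tsum_(s1, s2 <- r)
    (omega r1 ∙ s1 ⊗ beta s2 ⊗ alpha (psi r2)).

Definition r23r13 : tensor A (tensor A A) :=
  \tsum_(r1, r2 <- r) \tsum_(s1, s2 <- r)
    (beta (omega r1) ⊗ alpha s1 ⊗ s2 ∙ psi r2).

Definition r13 : tensor A (tensor A A) :=
  \tsum_(r1, r2 <- r) (omega r1 ⊗ one ⊗ psi r2).

Record anti_quasitriangular : Prop := {
  aqt_alg : unitary_BiHom_associative mu one alpha beta;
  aqt_alpha_bij : bijective alpha;
  aqt_beta_bij : bijective beta;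
  aqt_alpha_psi : commuting alpha psi;
  aqt_alpha_omega : commuting alpha omega;
  aqt_beta_psi : commuting beta psi;
  aqt_beta_omega : commuting beta omega;
  aqt_psiM : multiplicative_map mu psi;
  aqt_omegaM : multiplicative_map mu omega;
  aqt_psi1 : psi one = one;
  aqt_omega1 : omega one = one;
  aqt_alpha_r : (alpha ⊠ alpha) r = r;
  aqt_beta_r : (beta ⊠ beta) r = r;
  aqt_psi_r : (psi ⊠ psi) r = r;
  aqt_omega_r : (omega ⊠ omega) r = r;
  aqt_eq : r13r12 - r12r23 + r23r13 = - (lambda *: r13)
}.

Definition Delta_r (a : A) : tensor A A :=
    (\tsum_(r1, r2 <- r) (omega (linv alpha a) ∙ r1 ⊗ beta r2))
  - (\tsum_(r1, r2 <- r) (alpha r1 ⊗ r2 ∙ psi (linv beta a)))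
  - lambda *: (one ⊗ psi a).

Lemma Delta_r_is_linear : linear Delta_r.
Proof.
move=> c a b; rewrite /Delta_r.
rewrite (@eq_tsumP _ _ _ _ c
    (fun r1 r2 => omega (linv alpha (c *: a + b)) ∙ r1 ⊗ beta r2)
    (fun r1 r2 => omega (linv alpha a) ∙ r1 ⊗ beta r2)
    (fun r1 r2 => omega (linv alpha b) ∙ r1 ⊗ beta r2)); last first.
  by move=> x y; rewrite 2!linearP /= tens_linearl (linearP mu) /= tens_linearl.
rewrite (@eq_tsumP _ _ _ _ c
    (fun r1 r2 => alpha r1 ⊗ r2 ∙ psi (linv beta (c *: a + b)))
    (fun r1 r2 => alpha r1 ⊗ r2 ∙ psi (linv beta a))
    (fun r1 r2 => alpha r1 ⊗ r2 ∙ psi (linv beta b))); last first.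
  by move=> x y; rewrite 2!linearP /= tens_linearr (linearP mu) /= tens_linearr.
rewrite linearP /= tens_linearr scalerDr !scalerBr !scalerA (mulrC lambda c).
by rewrite !opprD [RHS]addrACA; congr (_ + _); exact: addrACA.
Qed.

HB.instance Definition _ :=
  GRing.isLinear.Build K A (tensor A A) _ Delta_r Delta_r_is_linear.

End AntiQuasitriangular.

Section Modules.
Variables (K : fieldType) (A : lmodType K).
Variables (mu : {linear tensor A A -> A}) (Delta : {linear A -> tensor A A}).
Variables (alphaA betaA psiA omegaA : {linear A -> A}).
Variables (M : lmodType K).
Variables (gamma : {linear tensor A M -> M}) (rho : {linear M -> tensor A M}).
Variables (alphaM betaM psiM omegaM : {linear M -> M}).
Local Notation "a ∙ b" := (mu (a ⊗ b)) (at level 36, right associativity).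
Local Notation "a ▷ m" := (gamma (a ⊗ m)) (at level 36, right associativity).

Record left_module : Prop := {
  lm_comm : commuting alphaM betaM;
  lm_alpha : forall a m, alphaM (a ▷ m) = alphaA a ▷ alphaM m;
  lm_beta : forall a m, betaM (a ▷ m) = betaA a ▷ betaM m;
  lm_assoc : forall a a' m, alphaA a ▷ a' ▷ m = (a ∙ a') ▷ betaM m
}.

Record left_comodule : Prop := {
  lc_comm : commuting psiM omegaM;
  lc_psi : forall m, rho (psiM m) = (psiA ⊠ psiM) (rho m);
  lc_omega : forall m, rho (omegaM m) = (omegaA ⊠ omegaM) (rho m);
  lc_coassoc : forall m,
    tassoc ((Delta ⊠ psiM) (rho m)) = (omegaA ⊠ rho) (rho m)
}.

End Modules.

Section HopfModule.
Variables (K : fieldType) (lambda : K) (A : lmodType K).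
Variables (mu : {linear tensor A A -> A}) (Delta : {linear A -> tensor A A}).
Variables (alphaA betaA psiA omegaA : {linear A -> A}).
Variables (M : lmodType K).
Variables (gamma : {linear tensor A M -> M}) (rho : {linear M -> tensor A M}).
Variables (alphaM betaM psiM omegaM : {linear M -> M}).
Local Notation "a ∙ b" := (mu (a ⊗ b)) (at level 36, right associativity).
Local Notation "a ▷ m" := (gamma (a ⊗ m)) (at level 36, right associativity).

Record left_infBH_Hopf_module : Prop := {
  hm_bialg : infBH_bialgebra lambda mu Delta alphaA betaA psiA omegaA;
  hm_module : left_module mu alphaA betaA gamma alphaM betaM;
  hm_comodule : left_comodule Delta psiA omegaA rho psiM omegaM;
  hm_alpha_beta : commuting alphaM betaM;
  hm_alpha_psi : commuting alphaM psiM;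
  hm_alpha_omega : commuting alphaM omegaM;
  hm_beta_psi : commuting betaM psiM;
  hm_beta_omega : commuting betaM omegaM;
  hm_psi_omega : commuting psiM omegaM;
  hm_compat : forall a m, rho (a ▷ m) =
      (\tsum_(m1, m0 <- rho m) (omegaA a ∙ m1 ⊗ betaM m0))
    + (\tsum_(a1, a2 <- Delta a) (alphaA a1 ⊗ a2 ▷ psiM m))
    + lambda *: (alphaA (omegaA a) ⊗ betaM (psiM m))
}.

End HopfModule.

Section Coaction.
Variables (K : fieldType) (lambda : K) (A : lmodType K) (one : A).
Variables (alphaA : {linear A -> A}) (r : tensor A A).
Variables (M : lmodType K) (gamma : {linear tensor A M -> M}).
Variables (betaM psiM : {linear M -> M}).
Local Notation "a ▷ m" := (gamma (a ⊗ m)) (at level 36, right associativity).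

Definition rho_r (m : M) : tensor A M :=
  - (\tsum_(r1, r2 <- r) (alphaA r1 ⊗ r2 ▷ psiM (linv betaM m)))
  - lambda *: (one ⊗ psiM m).

Lemma rho_r_is_linear : linear rho_r.
Proof.
move=> c m n; rewrite /rho_r.
rewrite (@eq_tsumP _ _ _ _ c _
    (fun r1 r2 => alphaA r1 ⊗ r2 ▷ psiM (linv betaM m))
    (fun r1 r2 => alphaA r1 ⊗ r2 ▷ psiM (linv betaM n))); last first.
  by move=> x y; rewrite 2!linearP /= tens_linearr (linearP gamma) /= tens_linearr.
rewrite linearP /= tens_linearr !scalerDr !scalerN !scalerA (mulrC lambda c).
by rewrite !opprD addrACA.
Qed.

HB.instance Definition _ :=
  GRing.isLinear.Build K M (tensor A M) _ rho_r rho_r_is_linear.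

End Coaction.

(* Main.v *)
Require Import Defs.
From HB Require Import structures.
From mathcomp Require Import all_boot all_algebra.
From mathcomp Require Import boolp.

Set Implicit Arguments.
Unset Strict Implicit.
Unset Printing Implicit Defensive.

Import GRing.Theory.
Local Open Scope ring_scope.

(* Since alpha, beta and betaM are invertible, the twists can be removed:
   m (a ⊗ b) = alpha^-1(a) beta^-1(b) is an associative product on A with unit
   1, n (a ⊗ x) = alpha^-1(a) ▷ betaM^-1(x) is an action of (A, m) on M, and
   alpha, beta, psi, omega become endomorphisms of (A, m) that fix r.  The
   invariance of r then turns the coproduct and the coaction into
     Delta(a) = (omega(a) ⊗ 1) r - r (1 ⊗ psi(a)) - lambda (1 ⊗ psi(a)),
     rho(x) = - r1 ⊗ r2 psi(x) - lambda (1 ⊗ psi(x)),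
   in which alpha and beta no longer occur, so the compatibility conditions are
   immediate.  Coassociativity of rho is the Yang-Baxter equation acting on
   psi^2(x) through its third leg; coassociativity of Delta is this equation
   multiplied by psi^2(a) on the right of the third leg together with the
   equation multiplied by omega^2(a) on the left of the first leg. *)

(** * Calculus of Sweedler sums *)

Section SweedlerCalculus.
Variable K : fieldType.

Definition bilinear_fun (U V W : lmodType K) (E : U -> V -> W) :=
  (forall v, linear (E^~ v)) /\ (forall u, linear (E u)).

Definition trilinear_fun (U V W X : lmodType K) (G : U -> V -> W -> X) :=
  (forall v w, linear (fun u => G u v w)) /\ forall u, bilinear_fun (G u).

Lemma tensPl (U V : lmodType K) (c : K) (u u' : U) (v : V) :
  (c *: u + u') ⊗ v = c *: (u ⊗ v) + u' ⊗ v.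
Proof. exact: tens_linearl. Qed.

Lemma tensPr (U V : lmodType K) (c : K) (u : U) (v v' : V) :
  u ⊗ (c *: v + v') = c *: (u ⊗ v) + u ⊗ v'.
Proof. exact: tens_linearr. Qed.

Lemma tensBl (U V : lmodType K) (u u' : U) (v : V) :
  (u - u') ⊗ v = u ⊗ v - u' ⊗ v.
Proof. by rewrite addrC -scaleN1r tensPl scaleN1r addrC. Qed.

Lemma tensBr (U V : lmodType K) (u : U) (v v' : V) :
  u ⊗ (v - v') = u ⊗ v - u ⊗ v'.
Proof. by rewrite addrC -scaleN1r tensPr scaleN1r addrC. Qed.

Lemma tens0l (U V : lmodType K) (v : V) : (0 : U) ⊗ v = 0.
Proof. by rewrite -(subrr 0) tensBl subrr. Qed.

Lemma tens0r (U V : lmodType K) (u : U) : u ⊗ (0 : V) = 0.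
Proof. by rewrite -(subrr 0) tensBr subrr. Qed.

Lemma tensZl (U V : lmodType K) (c : K) (u : U) (v : V) :
  (c *: u) ⊗ v = c *: (u ⊗ v).
Proof. by rewrite -[c *: u]addr0 tensPl tens0l addr0. Qed.

Lemma tensZr (U V : lmodType K) (c : K) (u : U) (v : V) :
  u ⊗ (c *: v) = c *: (u ⊗ v).
Proof. by rewrite -[c *: v]addr0 tensPr tens0r addr0. Qed.

Lemma tensNl (U V : lmodType K) (u : U) (v : V) : (- u) ⊗ v = - (u ⊗ v).
Proof. by rewrite -scaleN1r tensZl scaleN1r. Qed.

Lemma tensNr (U V : lmodType K) (u : U) (v : V) : u ⊗ (- v) = - (u ⊗ v).
Proof. by rewrite -scaleN1r tensZr scaleN1r. Qed.

(** While the tensor [t] stays fixed, sums run over the same chosen presentation and are compared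
    term by term for arbitrary summands. Changing the tensor changes the presentation, which is why
    the lemmas of the section [Bilinear] assume [bilinear_fun]. *)
Lemma eq_tsum (U V W : lmodType K) (E F : U -> V -> W) (t : tensor U V) :
  (forall x y, E x y = F x y) -> tsum E t = tsum F t.
Proof. by move=> EF; apply: eq_bigr => p _. Qed.

Lemma tsumB (U V W : lmodType K) (E F : U -> V -> W) (t : tensor U V) :
  \tsum_(x, y <- t) (E x y - F x y) = tsum E t - tsum F t.
Proof. by rewrite /tsum sumrB. Qed.

Lemma tsumN (U V W : lmodType K) (E : U -> V -> W) (t : tensor U V) :
  \tsum_(x, y <- t) (- E x y) = - tsum E t.
Proof. by rewrite /tsum sumrN. Qed.

Lemma tsumZ (U V W : lmodType K) (c : K) (E : U -> V -> W) (t : tensor U V) :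
  \tsum_(x, y <- t) (c *: E x y) = c *: tsum E t.
Proof. by rewrite /tsum scaler_sumr. Qed.

Lemma exchange_tsum (U V U' V' W : lmodType K) (E : U -> V -> U' -> V' -> W)
    (s : tensor U V) (t : tensor U' V') :
  \tsum_(x, y <- s) \tsum_(z, w <- t) E x y z w =
  \tsum_(z, w <- t) \tsum_(x, y <- s) E x y z w.
Proof. by rewrite /tsum exchange_big. Qed.

Lemma linear_tsum (U V W X : lmodType K) (f : {linear W -> X})
    (E : U -> V -> W) (t : tensor U V) :
  f (tsum E t) = \tsum_(x, y <- t) f (E x y).
Proof. by rewrite /tsum linear_sum. Qed.

Lemma tens_tsumr (U V W X : lmodType K) (x : X) (E : U -> V -> W)
    (t : tensor U V) : x ⊗ tsum E t = \tsum_(u, v <- t) (x ⊗ E u v).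
Proof.
rewrite /tsum; elim: (repr t) => [|p s IH]; first by rewrite !big_nil tens0r.
by rewrite !big_cons -IH -[E _ _]scale1r tensPr !scale1r.
Qed.

Lemma tens_tsuml (U V W X : lmodType K) (x : X) (E : U -> V -> W)
    (t : tensor U V) : tsum E t ⊗ x = \tsum_(u, v <- t) (E u v ⊗ x).
Proof.
rewrite /tsum; elim: (repr t) => [|p s IH]; first by rewrite !big_nil tens0l.
by rewrite !big_cons -IH -[E _ _]scale1r tensPl !scale1r.
Qed.

Section Bilinear.
Variables (U V W : lmodType K) (E : U -> V -> W).
Hypothesis bE : bilinear_fun E.

Lemma bilin_tens u v : tsum E (u ⊗ v) = E u v.
Proof. by case: bE => El Er; rewrite tsum_tens. Qed.

Lemma bilin_linear : linear (tsum E).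
Proof. by case: bE => El Er; exact: tsum_linear. Qed.

(** The linear structure on [tsum E] depends on the hypothesis [bE], so it is packed into a map [L],
    to which the general lemmas on linear maps apply. *)
Lemma bilinear_lift : exists L : {linear tensor U V -> W}, L =1 tsum E.
Proof.
pose L : {linear tensor U V -> W} :=
  HB.pack (tsum E) (GRing.isLinear.Build K _ _ _ _ bilin_linear).
by exists L.
Qed.

Lemma bilinB s t : tsum E (s - t) = tsum E s - tsum E t.
Proof. by case: bilinear_lift => L LE; rewrite -!LE linearB. Qed.

Lemma bilinN t : tsum E (- t) = - tsum E t.
Proof. by case: bilinear_lift => L LE; rewrite -!LE linearN. Qed.

Lemma bilinZ c t : tsum E (c *: t) = c *: tsum E t.
Proof. by case: bilinear_lift => L LE; rewrite -!LE linearZ. Qed.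

Lemma bilin_tsum (U' V' : lmodType K) (F : U' -> V' -> tensor U V) t :
  tsum E (tsum F t) = \tsum_(x, y <- t) tsum E (F x y).
Proof.
case: bilinear_lift => L LE; rewrite -LE linear_tsum.
by apply: eq_tsum => x y; rewrite LE.
Qed.

Lemma bilin_tmap (U' V' : lmodType K) (f : U' -> U) (g : V' -> V) t :
  tsum E ((f ⊠ g) t) = \tsum_(x, y <- t) E (f x) (g y).
Proof. by rewrite bilin_tsum; apply: eq_tsum => x y; rewrite bilin_tens. Qed.

End Bilinear.

End SweedlerCalculus.

(** Proves [bilinear_fun] goals. When the function is itself a Sweedler sum over a fixed tensor,
    [eq_tsumP] reduces linearity of the sum to that of its summand. *)
Ltac bilin :=
  split=> ? ? ? ? /=;
  try (apply: eq_tsumP => ? ?);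
  by rewrite ?(tensPl, tensPr, linearP) /= ?(tensPl, tensPr, linearP).

(** * Linearity of tensor products of maps and of the associator; trilinear maps *)

Section TensorMaps.
Variable K : fieldType.

Lemma tmap_is_linear (U U' V V' : lmodType K) (f : {linear U -> U'})
  (g : {linear V -> V'}) : linear (f ⊠ g).
Proof. by apply: bilin_linear; bilin. Qed.

HB.instance Definition _ (U U' V V' : lmodType K) (f : {linear U -> U'})
    (g : {linear V -> V'}) :=
  GRing.isLinear.Build K (tensor U V) (tensor U' V') _ (f ⊠ g)
    (tmap_is_linear f g).

Lemma tmap_tens (U U' V V' : lmodType K) (f : {linear U -> U'})
  (g : {linear V -> V'}) u v : (f ⊠ g) (u ⊗ v) = f u ⊗ g v.
Proof. by rewrite /tmap bilin_tens //; bilin. Qed.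

Lemma bilin_assoc_inner (U V W : lmodType K) (z : W) :
  bilinear_fun (fun (x : U) (y : V) => x ⊗ (y ⊗ z)).
Proof. by bilin. Qed.

Lemma bilin_assoc_outer (U V W : lmodType K) :
  bilinear_fun (fun (p : tensor U V) (z : W) => \tsum_(x, y <- p) (x ⊗ (y ⊗ z))).
Proof.
split=> [z|p c z z']; first exact: bilin_linear (bilin_assoc_inner _ _ z).
by apply: eq_tsumP => x y; rewrite !tensPr.
Qed.

Lemma tassoc_is_linear (U V W : lmodType K) : linear (@tassoc K U V W).
Proof. exact: bilin_linear (bilin_assoc_outer _ _ _). Qed.

HB.instance Definition _ (U V W : lmodType K) :=
  GRing.isLinear.Build K (tensor (tensor U V) W) (tensor U (tensor V W)) _
    (@tassoc K U V W) (@tassoc_is_linear U V W).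

Lemma tassocB (U V W : lmodType K) (s t : tensor (tensor U V) W) :
  tassoc (s - t) = tassoc s - tassoc t.
Proof. exact: linearB. Qed.

Lemma tassocN (U V W : lmodType K) (t : tensor (tensor U V) W) :
  tassoc (- t) = - tassoc t.
Proof. exact: linearN. Qed.

Lemma tassocZ (U V W : lmodType K) (c : K) (t : tensor (tensor U V) W) :
  tassoc (c *: t) = c *: tassoc t.
Proof. exact: linearZ. Qed.

Lemma tassoc_tsum (U V W U' V' : lmodType K)
    (E : U' -> V' -> tensor (tensor U V) W) t :
  tassoc (tsum E t) = \tsum_(x, y <- t) tassoc (E x y).
Proof. exact: linear_tsum. Qed.

Lemma tassoc_tens (U V W : lmodType K) (x : U) (y : V) (z : W) :
  tassoc ((x ⊗ y) ⊗ z) = x ⊗ y ⊗ z.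
Proof.
rewrite /tassoc (bilin_tens (bilin_assoc_outer _ _ _)).
by rewrite (bilin_tens (bilin_assoc_inner _ _ _)).
Qed.

(** The universal property, applied first to the last two legs and then to the first leg against the
    rest. It serves to transport an identity in a triple tensor product to an arbitrary trilinear
    expression. *)
Lemma trilinear_lift (U V W X : lmodType K) (G : U -> V -> W -> X) :
  trilinear_fun G ->
  exists L : {linear tensor U (tensor V W) -> X},
    forall x y z, L (x ⊗ y ⊗ z) = G x y z.
Proof.
case=> Gl Gr.
have bG : bilinear_fun (fun x p => tsum (G x) p).
  split=> [p c x x'|x]; last exact: bilin_linear.
  by apply: eq_tsumP => y z; exact: Gl.
case: (bilinear_lift bG) => L LE; exists L => x y z.
by rewrite LE (bilin_tens bG) bilin_tens.
Qed.

End TensorMaps.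

(** * The associative case: coproduct [D] on a unital algebra [m] *)

Section Untwisted.
Variables (K : fieldType) (lambda : K) (A : lmodType K).
Variables (m : {linear tensor A A -> A}) (one : A).
Variables (psi omega : {linear A -> A}) (r : tensor A A).
Local Notation "a ∙ b" := (m (a ⊗ b)) (at level 36, right associativity).

Hypothesis mulA : forall a b c, a ∙ (b ∙ c) = m (m (a ⊗ b) ⊗ c).
Hypothesis mul1l : forall a, one ∙ a = a.
Hypothesis mul1r : forall a, a ∙ one = a.
Hypothesis psiM : multiplicative_map m psi.
Hypothesis omegaM : multiplicative_map m omega.
Hypotheses (psi1 : psi one = one) (omega1 : omega one = one).
Hypotheses (psi_r : (psi ⊠ psi) r = r) (omega_r : (omega ⊠ omega) r = r).
Hypothesis psi_omega : commuting psi omega.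

(** This is how twists appear and disappear: a map fixing [r] may be inserted on both legs of a copy
    of [r], or removed from them. *)
Lemma invariant_tsum (f : A -> A) (W : lmodType K) (E : A -> A -> W) :
  (f ⊠ f) r = r -> bilinear_fun E ->
  \tsum_(x, y <- r) E (f x) (f y) = tsum E r.
Proof. by move=> fr bE; rewrite -[in RHS]fr bilin_tmap. Qed.

(** For [psi] and [omega] the identity, this is the associative Yang-Baxter equation of weight
    [lambda]: $r_{13}r_{12}-r_{12}r_{23}+r_{23}r_{13}=-\lambda r_{13}$. *)
Hypothesis yang_baxter :
  (\tsum_(x, y <- r) \tsum_(s, t <- r) (omega x ∙ s ⊗ t ⊗ psi y))
  - (\tsum_(x, y <- r) \tsum_(s, t <- r) (x ⊗ y ∙ s ⊗ t))
  + (\tsum_(x, y <- r) \tsum_(s, t <- r) (omega x ⊗ s ⊗ t ∙ psi y))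
  = - (lambda *: \tsum_(x, y <- r) (omega x ⊗ one ⊗ psi y)).

Lemma yang_baxter_trilinear (W : lmodType K) (G : A -> A -> A -> W) :
  trilinear_fun G ->
  (\tsum_(x, y <- r) \tsum_(s, t <- r) G (omega x ∙ s) t (psi y))
  - (\tsum_(x, y <- r) \tsum_(s, t <- r) G x (y ∙ s) t)
  + (\tsum_(x, y <- r) \tsum_(s, t <- r) G (omega x) s (t ∙ psi y))
  = - (lambda *: \tsum_(x, y <- r) G (omega x) one (psi y)).
Proof.
case/trilinear_lift=> L LE; have := congr1 L yang_baxter.
have L2 (F : A -> A -> A -> A -> tensor A (tensor A A)) :
    L (\tsum_(x, y <- r) \tsum_(s, t <- r) F x y s t) =
    \tsum_(x, y <- r) \tsum_(s, t <- r) L (F x y s t).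
  by rewrite linear_tsum; apply: eq_tsum => x y; rewrite linear_tsum.
rewrite linearD linearB linearN linearZ /= !L2 => LYB.
apply: etrans (etrans LYB _).
  by congr (_ - _ + _); do 2!apply: eq_tsum => ? ?.
by rewrite (linear_tsum L); congr (- (_ *: _)); apply: eq_tsum => ? ?.
Qed.

Variable D : {linear A -> tensor A A}.
Hypothesis DE : forall a, D a =
  \tsum_(x, y <- r) (omega a ∙ x ⊗ y)
  - \tsum_(x, y <- r) (x ⊗ y ∙ psi a) - lambda *: (one ⊗ psi a).

Lemma tsum_D (W : lmodType K) (E : A -> A -> W) a : bilinear_fun E ->
  tsum E (D a) = \tsum_(x, y <- r) E (omega a ∙ x) y
    - \tsum_(x, y <- r) E x (y ∙ psi a) - lambda *: E one (psi a).
Proof.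
move=> bE; rewrite DE !(bilinB bE) (bilinZ bE) !(bilin_tsum bE) (bilin_tens bE).
by congr (_ - _ - _); apply: eq_tsum => x y; rewrite bilin_tens.
Qed.

(** Both sums over [r] reduce to [r] itself at the unit, and they cancel. *)
Lemma D1 : D one = - (lambda *: (one ⊗ one)).
Proof.
rewrite DE [X in X - _ - _](eq_tsum (F := @tens _ _ _)); last first.
  by move=> x y; rewrite omega1 mul1l.
rewrite [X in _ - X - _](eq_tsum (F := @tens _ _ _)); last first.
  by move=> x y; rewrite psi1 mul1r.
by rewrite psi1 subrr sub0r.
Qed.

(** By multiplicativity, [f] reaches both legs of each copy of [r], where invariance absorbs it. The
    four structure maps are all instances of [f]. *)
Lemma D_equivariant (f : {linear A -> A}) a :
  multiplicative_map m f -> f one = one -> (f ⊠ f) r = r ->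
  commuting f psi -> commuting f omega -> (f ⊠ f) (D a) = D (f a).
Proof.
move=> fM f1 fr f_psi f_omega; rewrite /tmap tsum_D; last by bilin.
rewrite DE f1 f_psi; congr (_ - _ - _).
  rewrite -(invariant_tsum fr (E := fun x y => omega (f a) ∙ x ⊗ y)); last by bilin.
  by apply: eq_tsum => x y; rewrite fM f_omega.
rewrite -(invariant_tsum fr (E := fun x y => x ⊗ y ∙ psi (f a))); last by bilin.
by apply: eq_tsum => x y; rewrite fM f_psi.
Qed.

(** The mixed sum of [omega a ∙ x ⊗ y ∙ psi b] comes from [D b] with a minus sign and from [D a]
    with a plus sign. The last summand cancels the [lambda] term of [D b], and what remains is
    [D (a ∙ b)]. *)
Lemma D_mul a b : D (a ∙ b) =
  \tsum_(b1, b2 <- D b) (omega a ∙ b1 ⊗ b2)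
  + \tsum_(a1, a2 <- D a) (a1 ⊗ a2 ∙ psi b)
  + lambda *: (omega a ⊗ psi b).
Proof.
rewrite tsum_D; last by bilin.
rewrite tsum_D; last by bilin.
rewrite DE psiM omegaM mul1r.
under eq_tsum => x y do rewrite -mulA.
rewrite [X in _ - X - _ = _](eq_tsum
  (F := fun x y => x ⊗ m (m (y ⊗ psi a) ⊗ psi b))); last first.
  by move=> x y; rewrite mulA.
by rewrite [RHS]addrAC subrK !addrA subrK.
Qed.

Lemma tassoc_D a (W : lmodType K) (w : W) : tassoc (D a ⊗ w) =
  \tsum_(s, t <- r) (omega a ∙ s ⊗ t ⊗ w)
  - \tsum_(s, t <- r) (s ⊗ t ∙ psi a ⊗ w) - lambda *: (one ⊗ psi a ⊗ w).
Proof.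
rewrite DE !tensBl !tens_tsuml tensZl !tassocB tassocZ !tassoc_tsum.
rewrite tassoc_tens.
by congr (_ - _ - _); apply: eq_tsum => x y; rewrite tassoc_tens.
Qed.

Lemma D_coassoc a : tassoc ((D ⊠ psi) (D a)) = (omega ⊠ D) (D a).
Proof.
(* The [P] terms belong to the Yang-Baxter equation multiplied by [c] on the left of the first leg,
   the [Q] terms to the one multiplied by [a'] on the right of the third. [T], [S], [U], [V] are the
   terms common to both sides of coassociativity. *)
pose a' := psi (psi a); pose b := omega (psi a); pose c := omega (omega a).
pose P1 := \tsum_(x, y <- r) \tsum_(s, t <- r) (c ∙ omega x ∙ s ⊗ t ⊗ psi y).
pose P2 := \tsum_(x, y <- r) \tsum_(s, t <- r) (c ∙ x ⊗ y ∙ s ⊗ t).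
pose P3 := \tsum_(x, y <- r) \tsum_(s, t <- r) (c ∙ omega x ⊗ s ⊗ t ∙ psi y).
pose P4 := lambda *: \tsum_(x, y <- r) (c ∙ omega x ⊗ one ⊗ psi y).
pose Q1 := \tsum_(x, y <- r) \tsum_(s, t <- r)
  (omega x ∙ s ⊗ t ⊗ psi y ∙ a').
pose Q2 := \tsum_(x, y <- r) \tsum_(s, t <- r) (x ⊗ y ∙ s ⊗ t ∙ a').
pose Q3 := \tsum_(x, y <- r) \tsum_(s, t <- r)
  (omega x ⊗ s ⊗ t ∙ psi y ∙ a').
pose Q4 := lambda *: \tsum_(x, y <- r) (omega x ⊗ one ⊗ psi y ∙ a').
pose T := \tsum_(x, y <- r) \tsum_(s, t <- r) (x ⊗ y ∙ b ∙ s ⊗ t).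
pose S := lambda *: \tsum_(x, y <- r) (one ⊗ b ∙ x ⊗ y).
pose U := lambda *: \tsum_(x, y <- r) (one ⊗ x ⊗ y ∙ a').
pose V := lambda *: (lambda *: (one ⊗ one ⊗ a')).
have YP : P1 - P2 + P3 = - P4.
  apply: etrans (yang_baxter_trilinear (G := fun x y z => c ∙ x ⊗ y ⊗ z) _) => //.
  by split=> [? ? ? ? ?|?]; last bilin; rewrite !(tensPl, tensPr, linearP).
have YQ : Q1 - Q2 + Q3 = - Q4.
  apply: etrans (etrans (yang_baxter_trilinear
    (G := fun x y z => x ⊗ y ⊗ z ∙ a') _) _) => //.
  - by congr (_ - _ + _); do 2!apply: eq_tsum => ? ?; rewrite ?mulA.
  - by split=> [? ? ? ? ?|?]; last bilin; rewrite !(tensPl, tensPr, linearP).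
have LE : tassoc ((D ⊠ psi) (D a)) = (P1 - T - S) - (Q1 - Q2 - U) + V.
  rewrite /tmap tsum_D; last by bilin.
  rewrite !tassocB tassocZ !tassoc_tsum D1.
  congr (_ - _ + _).
  - under eq_tsum => x y do rewrite tassoc_D.
    rewrite !tsumB tsumZ; congr (_ - _ - (_ *: _)).
    + by do 2!apply: eq_tsum => ? ?; rewrite omegaM mulA.
    (* The outer copy of [r] carries [psi] on both legs, which invariance removes; in [T] it plays
       the role of the inner copy, hence the exchange. *)
    + rewrite /T exchange_tsum.
      rewrite -(invariant_tsum psi_r (E := fun x y =>
        \tsum_(s, t <- r) (s ⊗ t ∙ b ∙ x ⊗ y))); last by bilin.
      by do 2!apply: eq_tsum => ? ?; rewrite psiM psi_omega.
    + rewrite -(invariant_tsum psi_r (E := fun x y =>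
        one ⊗ b ∙ x ⊗ y)); last by bilin.
      by apply: eq_tsum => ? ?; rewrite psiM psi_omega.
  - under eq_tsum => x y do rewrite tassoc_D.
    rewrite !tsumB tsumZ; congr (_ - _ - (_ *: _)).
    + by do 2!apply: eq_tsum => ? ?; rewrite psiM.
    + rewrite /Q2 exchange_tsum.
      rewrite -(invariant_tsum psi_r (E := fun x y =>
        \tsum_(s, t <- r) (s ⊗ t ∙ x ⊗ y ∙ a'))); last by bilin.
      by do 2!apply: eq_tsum => ? ?; rewrite psiM.
    + rewrite -(invariant_tsum psi_r (E := fun x y =>
        one ⊗ x ⊗ y ∙ a')); last by bilin.
      by apply: eq_tsum => ? ?; rewrite psiM.
  - by rewrite tensNl tensZl tassocN tassocZ tassoc_tens scalerN opprK.
have RE : (omega ⊠ D) (D a) = (P2 - P3 - P4) - (T - Q3 - Q4) - (S - U - V).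
  rewrite /tmap tsum_D; last by bilin.
  rewrite omega1; congr (_ - _ - _).
  - under eq_tsum => x y do rewrite DE !tensBr !tens_tsumr tensZr.
    rewrite !tsumB tsumZ; congr (_ - _ - _).
    + rewrite /P2 -(invariant_tsum omega_r (E := fun x y =>
        \tsum_(s, t <- r) (c ∙ x ⊗ y ∙ s ⊗ t))); last by bilin.
      by do 2!apply: eq_tsum => ? ?; rewrite omegaM.
    + by do 2!apply: eq_tsum => ? ?; rewrite omegaM.
    + by congr (_ *: _); apply: eq_tsum => ? ?; rewrite omegaM.
  - under eq_tsum => x y do rewrite DE !tensBr !tens_tsumr tensZr.
    rewrite !tsumB tsumZ; congr (_ - _ - _).
    + rewrite /T -(invariant_tsum omega_r (E := fun x y =>
        \tsum_(s, t <- r) (x ⊗ y ∙ b ∙ s ⊗ t))); last by bilin.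
      by do 2!apply: eq_tsum => ? ?; rewrite omegaM mulA.
    + by do 2!apply: eq_tsum => ? ?; rewrite psiM.
    + by congr (_ *: _); apply: eq_tsum => ? ?; rewrite psiM.
  - rewrite DE !tensBr !tens_tsumr tensZr !scalerBr; congr (_ - _ - _).
(* The common terms match, so the two sides differ exactly by the instances [YP] and [YQ]. *)
have P1E : P1 = P2 - P3 - P4 by rewrite -YP [RHS]addrC addrA addrAC addrK subrK.
have YQ' : Q1 - Q2 = - Q3 - Q4.
  by rewrite -YQ [RHS]addrC addrK.
rewrite LE RE -P1E YQ' !opprD !opprK !addrA; congr (_ + _ + _).
by rewrite (addrAC _ (- S)) (addrAC _ (- S)).
Qed.

(** * The associative case: coaction [R] on a module *)

Variables (M : lmodType K) (n : {linear tensor A M -> M}).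
Variables (psiN : {linear M -> M}) (R : {linear M -> tensor A M}).
Local Notation "a ▷ x" := (n (a ⊗ x)) (at level 36, right associativity).
Hypothesis actA : forall a b x, a ▷ b ▷ x = n (m (a ⊗ b) ⊗ x).
Hypothesis psi_act : forall a x, psiN (a ▷ x) = psi a ▷ psiN x.
Hypothesis RE : forall x, R x =
  - (\tsum_(s, t <- r) (s ⊗ t ▷ psiN x)) - lambda *: (one ⊗ psiN x).

Lemma tsum_R (W : lmodType K) (E : A -> M -> W) x : bilinear_fun E ->
  tsum E (R x) = - (\tsum_(s, t <- r) E s (t ▷ psiN x)) - lambda *: E one (psiN x).
Proof.
move=> bE; rewrite RE (bilinB bE) (bilinN bE) (bilinZ bE) (bilin_tsum bE).
rewrite (bilin_tens bE); congr (- _ - _).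
by apply: eq_tsum => s t; rewrite bilin_tens.
Qed.

Lemma R_equivariant (f : {linear A -> A}) (g : {linear M -> M}) x :
  (forall a y, g (a ▷ y) = f a ▷ g y) -> f one = one -> (f ⊠ f) r = r ->
  commuting g psiN -> (f ⊠ g) (R x) = R (g x).
Proof.
move=> gf f1 fr g_psi; rewrite /tmap tsum_R; last by bilin.
rewrite RE f1 g_psi; congr (- _ - _).
rewrite -(invariant_tsum fr (E := fun s t => s ⊗ t ▷ psiN (g x))); last by bilin.
by apply: eq_tsum => s t; rewrite gf g_psi.
Qed.

(** The cancellation is that of [D_mul]: the sum of [omega a ∙ s ⊗ t ▷ psiN x] has opposite signs in
    [R x] and [D a], and the last summand removes the [lambda] term of [R x]. *)
Lemma R_act a x : R (a ▷ x) =
  \tsum_(s, y <- R x) (omega a ∙ s ⊗ y)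
  + \tsum_(a1, a2 <- D a) (a1 ⊗ a2 ▷ psiN x)
  + lambda *: (omega a ⊗ psiN x).
Proof.
rewrite tsum_R; last by bilin.
rewrite tsum_D; last by bilin.
rewrite RE psi_act mul1r [RHS]addrAC subrK.
under eq_tsum => s t do rewrite actA.
by rewrite !addrA addNr sub0r.
Qed.

(** Compared with [D], the map [R] lacks the sum in which [omega] multiplies the first leg of [r].
    Hence no analogue of the [P] terms of [D_coassoc] arises, and the single Yang-Baxter instance
    acting on [x'] suffices. *)
Lemma R_coassoc x : tassoc ((D ⊠ psiN) (R x)) = (omega ⊠ R) (R x).
Proof.
pose x' := psiN (psiN x).
pose Q1 := \tsum_(u, v <- r) \tsum_(s, t <- r)
  (omega u ∙ s ⊗ t ⊗ psi v ▷ x').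
pose Q2 := \tsum_(u, v <- r) \tsum_(s, t <- r) (u ⊗ v ∙ s ⊗ t ▷ x').
pose Q3 := \tsum_(u, v <- r) \tsum_(s, t <- r)
  (omega u ⊗ s ⊗ t ▷ psi v ▷ x').
pose Q4 := lambda *: \tsum_(u, v <- r) (omega u ⊗ one ⊗ psi v ▷ x').
pose U := lambda *: \tsum_(u, v <- r) (one ⊗ u ⊗ v ▷ x').
pose V := lambda *: (lambda *: (one ⊗ one ⊗ x')).
have YQ : Q1 - Q2 + Q3 = - Q4.
  apply: etrans (etrans (yang_baxter_trilinear
    (G := fun u v w => u ⊗ v ⊗ w ▷ x') _) _) => //.
  - by congr (_ - _ + _); do 2!apply: eq_tsum => ? ?; rewrite ?actA.
  - by split=> [? ? ? ? ?|?]; last bilin; rewrite !(tensPl, tensPr, linearP).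
have LE : tassoc ((D ⊠ psiN) (R x)) = - (Q1 - Q2 - U) + V.
  rewrite /tmap tsum_R; last by bilin.
  rewrite tassocB tassocN tassocZ tassoc_tsum D1.
  congr (- _ + _).
  - under eq_tsum => u v do rewrite tassoc_D.
    rewrite !tsumB tsumZ; congr (_ - _ - (_ *: _)).
    + by do 2!apply: eq_tsum => ? ?; rewrite psi_act.
    + rewrite /Q2 exchange_tsum.
      rewrite -(invariant_tsum psi_r (E := fun u v =>
        \tsum_(s, t <- r) (s ⊗ t ∙ u ⊗ v ▷ x'))); last by bilin.
      by do 2!apply: eq_tsum => ? ?; rewrite psi_act.
    + rewrite -(invariant_tsum psi_r (E := fun u v =>
        one ⊗ u ⊗ v ▷ x')); last by bilin.
      by apply: eq_tsum => ? ?; rewrite psi_act.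
  - by rewrite tensNl tensZl tassocN tassocZ tassoc_tens scalerN opprK.
have RE' : (omega ⊠ R) (R x) = Q3 + Q4 + U + V.
  rewrite /tmap tsum_R; last by bilin.
  rewrite omega1.
  under eq_tsum => u v do
    rewrite RE tensBr tensNr tens_tsumr tensZr psi_act.
  rewrite tsumB tsumN tsumZ RE tensBr tensNr tens_tsumr tensZr.
  by rewrite opprD !opprK scalerBr scalerN opprD !opprK addrA.
rewrite LE RE' opprB; congr (_ + _).
rewrite [RHS]addrC; congr (_ + _).
by rewrite -[Q4]opprK -YQ [- (_ + Q3)]opprD [RHS]addrC subrK.
Qed.

End Untwisted.

(** * Removing the twists from a BiHom-module *)

Section Twist.
Variables (K : fieldType) (A : lmodType K) (mu : {linear tensor A A -> A}).
Variables (alpha beta : {linear A -> A}).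

(** With [M := A], [gamma := mu] and [betaM := beta] this is the untwisted product, so the lemmas
    below serve both the algebra and the module. *)
Definition twist (M : lmodType K) (gamma : {linear tensor A M -> M})
    (betaM : {linear M -> M}) : {linear tensor A M -> M} :=
  gamma \o (linv alpha ⊠ linv betaM).

Hypotheses (alpha_bij : bijective alpha) (beta_bij : bijective beta).
Variables (M : lmodType K) (gamma : {linear tensor A M -> M}).
Variable betaM : {linear M -> M}.
Hypothesis betaM_bij : bijective betaM.

Lemma twistE a x : twist gamma betaM (alpha a ⊗ betaM x) = gamma (a ⊗ x).
Proof. by rewrite /twist /= tmap_tens /= !linvK. Qed.

Lemma twist_morph (f : {linear A -> A}) (g : {linear M -> M}) a x :
  (forall b y, g (gamma (b ⊗ y)) = gamma (f b ⊗ g y)) ->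
  commuting f alpha -> commuting g betaM ->
  g (twist gamma betaM (a ⊗ x)) = twist gamma betaM (f a ⊗ g x).
Proof.
move=> gf f_alpha g_beta.
rewrite -(linvVK alpha_bij a) -(linvVK betaM_bij x).
by rewrite f_alpha g_beta !twistE gf.
Qed.

Lemma twist_assoc (alphaM : {linear M -> M}) a b x :
  BiHom_associative mu alpha beta ->
  left_module mu alpha beta gamma alphaM betaM ->
  twist gamma betaM (a ⊗ twist gamma betaM (b ⊗ x)) =
  twist gamma betaM (twist mu beta (a ⊗ b) ⊗ x).
Proof.
move=> hA hM.
have muE c d : mu (c ⊗ d) = twist mu beta (alpha c ⊗ beta d).
  by rewrite /twist /= tmap_tens /= !linvK.
(* Write $a=\alpha^2(a')$, $b=\alpha\beta(b')$, $x=\beta_M^2(x')$. With these exponents every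
   inverse meets its map, and both sides become $(a'b')\triangleright\beta_M(x')$ by [lm_assoc]. *)
rewrite -(linvVK alpha_bij a) -(linvVK alpha_bij (linv alpha a)).
rewrite -(linvVK alpha_bij b) -(linvVK beta_bij (linv alpha b)).
rewrite -(linvVK betaM_bij x) -(linvVK betaM_bij (linv betaM x)).
set a' := linv _ _; set b' := linv beta _; set x' := linv betaM _.
rewrite twistE -(lm_beta hM) twistE (lm_assoc hM) (bha_comm hA) -muE.
by rewrite -(bha_alphaM hA) twistE.
Qed.

End Twist.

(** Makes associativity of the untwisted product an instance of [twist_assoc]. *)
Lemma left_regular_module (K : fieldType) (A : lmodType K)
    (mu : {linear tensor A A -> A}) (alpha beta : {linear A -> A}) :
  BiHom_associative mu alpha beta -> left_module mu alpha beta mu alpha beta.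
Proof. by case. Qed.

(** * The bialgebra structure given by [Delta_r] *)

Section AntiQuasitriangular.
Variables (K : fieldType) (lambda : K) (A : lmodType K).
Variables (mu : {linear tensor A A -> A}) (one : A).
Variables (alpha beta psi omega : {linear A -> A}) (r : tensor A A).
Hypothesis hA : anti_quasitriangular lambda mu one alpha beta psi omega r.
Local Notation m := (twist alpha mu beta).
Local Notation D := (Delta_r lambda mu one alpha beta psi omega r).

Let hU := aqt_alg hA.
Let hAssoc := ubha_assoc hU.
Let alpha_bij := aqt_alpha_bij hA.
Let beta_bij := aqt_beta_bij hA.

Lemma aqt_mulE a b : mu (a ⊗ b) = m (alpha a ⊗ beta b).
Proof. by rewrite twistE. Qed.

Lemma aqt_mulA a b c : m (a ⊗ m (b ⊗ c)) = m (m (a ⊗ b) ⊗ c).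
Proof.
exact: (twist_assoc alpha_bij beta_bij beta_bij _ _ _ hAssoc
  (left_regular_module hAssoc)).
Qed.

Lemma aqt_mul1l a : m (one ⊗ a) = a.
Proof.
rewrite -(linvVK beta_bij a) -(ubha_alpha1 hU) -aqt_mulE.
exact: (ubha_mul1r hU).
Qed.

Lemma aqt_mul1r a : m (a ⊗ one) = a.
Proof.
rewrite -(linvVK alpha_bij a) -(ubha_beta1 hU) -aqt_mulE.
exact: (ubha_mulr1 hU).
Qed.

Lemma aqt_multiplicative (f : {linear A -> A}) :
  multiplicative_map mu f -> commuting f alpha -> commuting f beta ->
  multiplicative_map m f.
Proof. by move=> fM fa fb a b; apply: twist_morph. Qed.

Let alphaM : multiplicative_map m alpha.
Proof. by apply: aqt_multiplicative (bha_alphaM hAssoc) _ (bha_comm hAssoc). Qed.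

Let betaM : multiplicative_map m beta.
Proof.
apply: aqt_multiplicative (bha_betaM hAssoc) _ _ => // a.
by rewrite (bha_comm hAssoc).
Qed.

Lemma aqt_psi_multiplicative : multiplicative_map m psi.
Proof.
apply: aqt_multiplicative (aqt_psiM hA) _ _ => a.
  by rewrite (aqt_alpha_psi hA).
by rewrite (aqt_beta_psi hA).
Qed.

Lemma aqt_omega_multiplicative : multiplicative_map m omega.
Proof.
apply: aqt_multiplicative (aqt_omegaM hA) _ _ => a.
  by rewrite (aqt_alpha_omega hA).
by rewrite (aqt_beta_omega hA).
Qed.

(* Invariance of [r] under [alpha] and [beta] absorbs every twist in the
   equation, leaving the associative one for the product [m]. *)
Lemma aqt_yang_baxter :
  (\tsum_(x, y <- r) \tsum_(s, t <- r) (m (omega x ⊗ s) ⊗ t ⊗ psi y))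
  - (\tsum_(x, y <- r) \tsum_(s, t <- r) (x ⊗ m (y ⊗ s) ⊗ t))
  + (\tsum_(x, y <- r) \tsum_(s, t <- r) (omega x ⊗ s ⊗ m (t ⊗ psi y)))
  = - (lambda *: \tsum_(x, y <- r) (omega x ⊗ one ⊗ psi y)).
Proof.
rewrite -/(r13 one psi omega r) -(aqt_eq hA); congr (_ - _ + _).
- rewrite -(invariant_tsum (aqt_alpha_r hA) (E := fun x y =>
    \tsum_(s, t <- r) (m (omega x ⊗ s) ⊗ t ⊗ psi y))); last by bilin.
  apply: eq_tsum => x y.
  rewrite -(invariant_tsum (aqt_beta_r hA) (E := fun s t =>
    m (omega (alpha x) ⊗ s) ⊗ t ⊗ psi (alpha y))); last by bilin.
  apply: eq_tsum => s t.
  by rewrite aqt_mulE (aqt_alpha_psi hA) (aqt_alpha_omega hA).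
- rewrite -(invariant_tsum (aqt_alpha_r hA) (E := fun x y =>
    \tsum_(s, t <- r) (x ⊗ m (y ⊗ s) ⊗ t))); last by bilin.
  apply: eq_tsum => x y.
  rewrite -(invariant_tsum (aqt_beta_r hA) (E := fun s t =>
    alpha x ⊗ m (alpha y ⊗ s) ⊗ t)); last by bilin.
  by apply: eq_tsum => s t; rewrite aqt_mulE.
- rewrite -(invariant_tsum (aqt_beta_r hA) (E := fun x y =>
    \tsum_(s, t <- r) (omega x ⊗ s ⊗ m (t ⊗ psi y)))); last by bilin.
  apply: eq_tsum => x y.
  rewrite -(invariant_tsum (aqt_alpha_r hA) (E := fun s t =>
    omega (beta x) ⊗ s ⊗ m (t ⊗ psi (beta y)))); last by bilin.
  apply: eq_tsum => s t.
  by rewrite aqt_mulE (aqt_beta_psi hA) (aqt_beta_omega hA).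
Qed.

(** Inserting [beta] on both legs of the first copy of [r] and [alpha] on both legs of the second
    gives [m] exactly the twists that turn it back into [mu]. *)
Lemma aqt_DeltaE a : D a =
  \tsum_(x, y <- r) (m (omega a ⊗ x) ⊗ y)
  - \tsum_(x, y <- r) (x ⊗ m (y ⊗ psi a)) - lambda *: (one ⊗ psi a).
Proof.
congr (_ - _ - _).
  rewrite -(invariant_tsum (aqt_beta_r hA) (E := fun x y =>
    m (omega a ⊗ x) ⊗ y)); last by bilin.
  apply: eq_tsum => x y.
  by rewrite aqt_mulE (aqt_alpha_omega hA) linvVK.
rewrite -(invariant_tsum (aqt_alpha_r hA) (E := fun x y =>
  x ⊗ m (y ⊗ psi a))); last by bilin.
apply: eq_tsum => x y.
by rewrite aqt_mulE (aqt_beta_psi hA) linvVK.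
Qed.

Let Delta_equivariant (f : {linear A -> A}) a :
  multiplicative_map m f -> f one = one -> (f ⊠ f) r = r ->
  commuting f psi -> commuting f omega -> (f ⊠ f) (D a) = D (f a).
Proof. by apply: D_equivariant; exact: aqt_DeltaE. Qed.

Let Delta_alpha a : (alpha ⊠ alpha) (D a) = D (alpha a).
Proof.
exact: Delta_equivariant (ubha_alpha1 hU) (aqt_alpha_r hA) (aqt_alpha_psi hA)
  (aqt_alpha_omega hA).
Qed.

Let Delta_beta a : (beta ⊠ beta) (D a) = D (beta a).
Proof.
exact: Delta_equivariant (ubha_beta1 hU) (aqt_beta_r hA) (aqt_beta_psi hA)
  (aqt_beta_omega hA).
Qed.

(** Used to pass from the untwisted compatibility back to the twisted one, where the coproduct is
    taken at [a] rather than at [alpha a]. *)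
Lemma tsum_Delta_alpha (W : lmodType K) (E : A -> A -> W) a :
  bilinear_fun E ->
  tsum E (D (alpha a)) = \tsum_(x, y <- D a) E (alpha x) (alpha y).
Proof. by move=> bE; rewrite -Delta_alpha bilin_tmap. Qed.

Lemma tsum_Delta_beta (W : lmodType K) (E : A -> A -> W) a :
  bilinear_fun E ->
  tsum E (D (beta a)) = \tsum_(x, y <- D a) E (beta x) (beta y).
Proof. by move=> bE; rewrite -Delta_beta bilin_tmap. Qed.

(** Commutation of [psi] and [omega] is part of [BiHom_coassociative] but not a field of
    [anti_quasitriangular], hence the premise. *)
Lemma aqt_bialgebra : commuting psi omega ->
  infBH_bialgebra lambda mu D alpha beta psi omega.
Proof.
move=> psi_omega.
have psi1 := aqt_psi1 hA; have omega1 := aqt_omega1 hA.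
have psi_r := aqt_psi_r hA; have omega_r := aqt_omega_r hA.
have psiM := aqt_psi_multiplicative; have omegaM := aqt_omega_multiplicative.
split; try by case: hA.
- split=> // [a|a|a].
  + exact: Delta_equivariant.
  + by apply: Delta_equivariant => // x; rewrite psi_omega.
  + exact: (D_coassoc aqt_mulA aqt_mul1l aqt_mul1r psiM omegaM psi1 omega1
      psi_r omega_r psi_omega aqt_yang_baxter aqt_DeltaE).
(* [D_mul] is applied to [alpha a] and [beta b]; equivariance of [D] then moves [alpha] and [beta]
   onto the legs, and each [m] becomes [mu] again. *)
move=> a b; rewrite aqt_mulE.
rewrite (D_mul aqt_mulA aqt_mul1r psiM omegaM aqt_DeltaE).
rewrite tsum_Delta_beta; last by bilin.
rewrite tsum_Delta_alpha; last by bilin.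
rewrite (aqt_alpha_omega hA) (aqt_beta_psi hA).
congr (_ + _ + _); apply: eq_tsum => x y; rewrite aqt_mulE.
  by rewrite (aqt_alpha_omega hA).
by rewrite (aqt_beta_psi hA).
Qed.

End AntiQuasitriangular.

(** * The Hopf module *)

Theorem theorem3p19 (K : fieldType) (lambda : K) (A : lmodType K)
  (mu : {linear tensor A A -> A}) (one : A)
  (alphaA betaA psiA omegaA : {linear A -> A}) (r : tensor A A)
  (hA : anti_quasitriangular lambda mu one alphaA betaA psiA omegaA r)
  (* part of (A, Delta_r, psiA, omegaA) being a BiHom-coalgebra *)
  (hA_psi_omega : commuting psiA omegaA)
  (M : lmodType K) (gamma : {linear tensor A M -> M})
  (alphaM betaM : {linear M -> M})
  (hM : left_module mu alphaA betaA gamma alphaM betaM)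
  (psiM omegaM : {linear M -> M})
  (h_beta_psi : forall m, betaM (psiM m) = psiM (betaM m))
  (h_psi_gamma : forall a m,
     psiM (gamma (a ⊗ m)) = gamma (psiA a ⊗ psiM m))
  (h_beta_bij : bijective betaM)
  (* A Hopf module requires the four maps to commute pairwise and rho to
     intertwine omegaM with omegaA ⊠ omegaM; neither follows from the above. *)
  (h_alpha_psi : commuting alphaM psiM)
  (h_alpha_omega : commuting alphaM omegaM)
  (h_beta_omega : commuting betaM omegaM)
  (h_psi_omega : commuting psiM omegaM)
  (h_omega_gamma : forall a m,
     omegaM (gamma (a ⊗ m)) = gamma (omegaA a ⊗ omegaM m)) :
  left_infBH_Hopf_module lambda mu
    (Delta_r lambda mu one alphaA betaA psiA omegaA r)
    alphaA betaA psiA omegaA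
    gamma (rho_r lambda one alphaA r gamma betaM psiM)
    alphaM betaM psiM omegaM.
Proof.
have hU := aqt_alg hA; have hAssoc := ubha_assoc hU.
have alpha_bij := aqt_alpha_bij hA.
pose m := twist alphaA mu betaA; pose n := twist alphaA gamma betaM.
have nE a x : gamma (a ⊗ x) = n (alphaA a ⊗ betaM x) by rewrite /n twistE.
have nA a b x : n (a ⊗ n (b ⊗ x)) = n (m (a ⊗ b) ⊗ x).
  exact: (twist_assoc alpha_bij (aqt_beta_bij hA) h_beta_bij _ _ _ hAssoc hM).
have psi_n a x : psiM (n (a ⊗ x)) = n (psiA a ⊗ psiM x).
  by apply: twist_morph => // y; rewrite (aqt_alpha_psi hA).
have omega_n a x : omegaM (n (a ⊗ x)) = n (omegaA a ⊗ omegaM x).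
  by apply: twist_morph => // y; rewrite (aqt_alpha_omega hA).
have beta_n a x : betaM (n (a ⊗ x)) = n (betaA a ⊗ betaM x).
  apply: twist_morph => // [b y|y]; first exact: (lm_beta hM).
  by rewrite (bha_comm hAssoc).
pose rho : {linear M -> tensor A M} :=
  rho_r lambda one alphaA r gamma betaM psiM.
have rhoE x : rho x =
    - (\tsum_(s, t <- r) (s ⊗ n (t ⊗ psiM x))) - lambda *: (one ⊗ psiM x).
  congr (- _ - _).
  (* With [alphaA] inserted on both legs, [n] becomes [gamma] once [psiM x] is written as [betaM] of
     [psiM (linv betaM x)]. *)
  rewrite -(invariant_tsum (aqt_alpha_r hA) (E := fun s t =>
    s ⊗ n (t ⊗ psiM x))); last by bilin.
  by apply: eq_tsum => s t; rewrite nE h_beta_psi linvVK.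
have rho_beta x : (betaA ⊠ betaM) (rho x) = rho (betaM x).
  exact: (R_equivariant rhoE x beta_n (ubha_beta1 hU) (aqt_beta_r hA)).
split=> //.
- exact: aqt_bialgebra.
- split=> // x.
  + by rewrite (R_equivariant rhoE x psi_n (aqt_psi1 hA) (aqt_psi_r hA)).
  + by rewrite (R_equivariant rhoE x omega_n (aqt_omega1 hA) (aqt_omega_r hA)).
  + exact: (R_coassoc (aqt_mul1l hA) (aqt_mul1r hA) (aqt_psi1 hA)
      (aqt_omega1 hA) (aqt_psi_r hA) (aqt_yang_baxter hA) (aqt_DeltaE hA)
      nA psi_n rhoE).
- exact: lm_comm hM.
(* [R_act] is applied to [alphaA a] and [betaM x]; [rho_beta] and [tsum_Delta_alpha] then pull the
   twists out of the coaction and the coproduct. *)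
move=> a x; rewrite nE.
rewrite (R_act (aqt_mul1r hA) (aqt_DeltaE hA) nA psi_n rhoE).
rewrite -rho_beta bilin_tmap; last by bilin.
rewrite (tsum_Delta_alpha hA); last by bilin.
rewrite (aqt_alpha_omega hA) h_beta_psi.
congr (_ + _ + _); apply: eq_tsum => y z.
  by rewrite (aqt_mulE hA) (aqt_alpha_omega hA).
by rewrite nE h_beta_psi.
Qed.
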